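(* Let $A\in\mathbb{R}^{n\times n}$ and $0\neq b\in\mathbb{R}^n$. Let $x_k^{(\mathrm{e})}$ denote the $k$-th iterate of standard GMRES performed exactly, with residual vector $r_k^{(\mathrm{e})}=b-Ax_k^{(\mathrm{e})}$. Suppose that $k$ steps of the Arnoldi algorithm are run with inexact inner products with errors $\eta_{ij}$ ($1\le i\le j\le k$), as described in the context, producing $\beta=\|b\|_2$, $V_{k+1}$ and $H_k$, without breakdown (i.e. $h_{j+1,j}\neq 0$ for $j=1,\dots,k$). Let $y_k$ and $t_k=\beta e_1-H_ky_k$ be the least squares solution and residual vector of $\min_{y\in\mathbb{R}^k}\|\beta e_1-H_ky\|_2$, and let $x_k=V_ky_k$ and $r_k=b-Ax_k$ be the resulting GMRES iterate and residual vector. For $1\le j<k$ let $t_j$ be the residual vector of $\min_{y\in\mathbb{R}^j}\|\beta e_1-H_jy\|_2$, and let $t_0=\beta e_1$. Let $\epsilon\in(0,1)$ and let $\phi_1,\dots,\phi_k$ be any positive numbers with $\sum_{j=1}^k\phi_j^2\le 1$. If for all $j=1,\dots,k$ and all $1\le i\le j$ $$|\eta_{ij}|\le \eta_j:=\frac{\phi_j\,\epsilon\,\sigma_{\min}(H_k)}{\sqrt{2}}\,\frac{\|b\|_2}{\|t_{j-1}\|_2},$$ then at step $k$ either $$1\le\frac{\|r_k\|_2}{\|r_k^{(\mathrm{e})}\|_2}\le\sqrt{3},$$ or $$\frac{\|t_k\|_2}{\|b\|_2}\le 6k\epsilon$$ (that is, GMRES has converged to a relative residual of $6k\epsilon$)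.
   Context: Standard exact GMRES: the $k$-th iterate $x_k^{(\mathrm{e})}$ minimizes $\|b-Ax\|_2$ over $x$ in the Krylov subspace $\mathcal{K}_k(A,b)=\mathrm{span}\{b,Ab,\dots,A^{k-1}b\}$. Arnoldi algorithm with inexact inner products: set $\beta=\sqrt{b^Tb}=\|b\|_2$ and $v_1=b/\beta$. For $j=1,2,\dots,k$: set $w_j^{(0)}=Av_j$; for $i=1,\dots,j$ set $h_{ij}=v_i^Tw_j^{(i-1)}+\eta_{ij}$, where $\eta_{ij}\in\mathbb{R}$ is the error in the inner product, and $w_j^{(i)}=w_j^{(i-1)}-h_{ij}v_i$; then set $h_{j+1,j}=\|w_j^{(j)}\|_2$ and $v_{j+1}=w_j^{(j)}/h_{j+1,j}$. Everything except the inner products defining $h_{ij}$ for $i\le j$ is computed exactly; in particular every $v_j$ is normalized exactly, $\|v_j\|_2=1$. It is assumed there is no breakdown: $h_{j+1,j}\ne 0$ for $j=1,\dots,k$. Notation: $V_j=[v_1,\dots,v_j]\in\mathbb{R}^{n\times j}$; $H_j\in\mathbb{R}^{(j+1)\times j}$ is the upper-Hessenberg matrix with entries $h_{i\ell}$ for $i\le\ell+1$ and zeros elsewhere, so that $AV_j=V_{j+1}H_j$. The columns of $V_{k+1}$ need not be orthogonal. $e_1$ is the first standard basis vector (of the appropriate dimension, $\mathbb{R}^{j+1}$ when it appears with $H_j$), and $\sigma_{\min}(H_k)$ is the smallest (i.e. $k$-th largest) singular value of $H_k$. *)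

(* Defs.v *)
From HB Require Import structures.
From mathcomp Require Import all_boot all_order all_algebra.
From mathcomp Require Import boolp classical_sets reals.
Set Implicit Arguments.
Unset Strict Implicit.
Unset Printing Implicit Defensive.
Import Order.TTheory GRing.Theory Num.Theory.
Local Open Scope ring_scope.

(* Euclidean norm; the norm that MathComp-Analysis puts on matrices is the
   max norm. *)
Definition norm2 (R : realType) (n : nat) (x : 'cV[R]_n) : R :=
  Num.sqrt ((x^T *m x) 0 0).

(* For p <= m, the square roots of the eigenvalues of M^T M are exactly the
   singular values of M. *)
Definition singular_value (R : realType) (m p : nat) (M : 'M[R]_(m, p))
    (s : R) : Prop :=
  0 <= s /\ eigenvalue (M^T *m M) (s ^+ 2).

(* For 0 < p <= m the set is finite and nonempty, so the infimum is attained. *)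
Definition sigma_min (R : realType) (m p : nat) (M : 'M[R]_(m, p)) : R :=
  inf [set s : R | singular_value M s]%classic.

Definition lsq_solution (R : realType) (m p : nat) (M : 'M[R]_(m, p))
    (c : 'cV[R]_m) (y : 'cV[R]_p) : Prop :=
  forall z : 'cV[R]_p, norm2 (c - M *m y) <= norm2 (c - M *m z).

Definition lsq_residual (R : realType) (m p : nat) (M : 'M[R]_(m, p))
    (c : 'cV[R]_m) (t : 'cV[R]_m) : Prop :=
  exists2 y : 'cV[R]_p, lsq_solution M c y & t = c - M *m y.

Definition krylov (R : realType) (n : nat) (A : 'M[R]_n) (b : 'cV[R]_n)
    (k : nat) : {vspace 'cV[R]_n} :=
  <<[seq (A ^+ i) *m b | i <- iota 0 k]>>%VS.

(* When A is singular the minimizer need not be unique, but its residual is. *)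
Definition gmres_iterate (R : realType) (n : nat) (A : 'M[R]_n)
    (b : 'cV[R]_n) (k : nat) (x : 'cV[R]_n) : Prop :=
  x \in krylov A b k /\
  forall z : 'cV[R]_n, z \in krylov A b k ->
    norm2 (b - A *m x) <= norm2 (b - A *m z).

(* Indices are 1-based: v j is v_j, h i j is h_{ij}, eta i j is eta_{ij} and
   w j i is w_j^{(i)}; values outside the stated ranges are irrelevant. *)
Record inexact_arnoldi (R : realType) (n : nat) (A : 'M[R]_n) (b : 'cV[R]_n)
    (k : nat) (eta : nat -> nat -> R) (v : nat -> 'cV[R]_n)
    (h : nat -> nat -> R) (w : nat -> nat -> 'cV[R]_n) : Prop := {
  arnoldi_start : v 1%N = (norm2 b)^-1 *: b;
  arnoldi_w0 : forall j, (1 <= j <= k)%N -> w j 0%N = A *m v j;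
  arnoldi_h : forall i j, (1 <= i <= j)%N -> (j <= k)%N ->
    h i j = ((v i)^T *m w j i.-1) 0 0 + eta i j;
  arnoldi_w : forall i j, (1 <= i <= j)%N -> (j <= k)%N ->
    w j i = w j i.-1 - h i j *: v i;
  arnoldi_hsub : forall j, (1 <= j <= k)%N -> h j.+1 j = norm2 (w j j);
  arnoldi_v : forall j, (1 <= j <= k)%N ->
    v j.+1 = (h j.+1 j)^-1 *: w j j
}.

(* V_j = [v_1, ..., v_j] *)
Definition basis_mx (R : realType) (n : nat) (v : nat -> 'cV[R]_n) (j : nat) :
    'M[R]_(n, j) :=
  \matrix_(i < n, l < j) v l.+1 i 0.

(* H_j: the 1-based entry (i, l) is h_{il} for i <= l + 1. *)
Definition hessenberg_mx (R : realType) (h : nat -> nat -> R) (j : nat) :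
    'M[R]_(j.+1, j) :=
  \matrix_(i < j.+1, l < j) if (i <= l.+1)%N then h i.+1 l.+1 else 0.

Definition e1 (R : realType) (m : nat) : 'cV[R]_m.+1 := delta_mx ord0 ord0.
Arguments e1 {R} m.

(* Main.v *)
Require Import Defs.
From HB Require Import structures.
From mathcomp Require Import all_boot all_order all_algebra.
From mathcomp Require Import boolp classical_sets reals.
From mathcomp Require Import ring lra.
Set Implicit Arguments.
Unset Strict Implicit.
Unset Printing Implicit Defensive.
Import Order.TTheory GRing.Theory Num.Theory.
Local Open Scope ring_scope.

(** Write [V = V_{k+1}] and let [U] be the strict upper triangle of [V^T V],
    so that [V^T V = 1 + U + U^T].  Orthogonalisation gives [U H_k = - N] with
    [N] the upper triangular matrix of the errors [eta_{ij}], and [U e_1 = 0];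
    hence a residual [g = beta e_1 - H_k z] satisfies [U g = N z].  Comparing
    [z] with the zero-padded minimiser of the [l]-th projected problem yields
    [sigma_min(H_k) |z_{l+1}| <= |t_l| + |g|], so when [|t_k| > 6 k eps |b|]
    the bound on the errors gives [|U g| <= |g| / 4], and therefore
    [|g|^2 / 2 <= |V g|^2 <= 3 |g|^2 / 2] for every such [g].  Both [r_k] and
    the exact GMRES residual have the form [V g], the former with the [g] of
    smallest norm, namely [t_k]. *)

(** * Euclidean inner product, Cauchy-Schwarz, positive semidefinite forms *)

Definition dot (R : pzRingType) (n : nat) (x y : 'cV[R]_n) : R :=
  (x^T *m y) 0 0.

Section Dot.
Variables (R : realType) (n : nat).
Implicit Types x y z : 'cV[R]_n.

Lemma dotE x y : dot x y = \sum_i x i 0 * y i 0.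
Proof. by rewrite /dot mxE; apply: eq_bigr => i _; rewrite mxE. Qed.

Lemma dotC x y : dot x y = dot y x.
Proof. by rewrite !dotE; apply: eq_bigr => i _; rewrite mulrC. Qed.

Lemma dotDl x y z : dot (x + y) z = dot x z + dot y z.
Proof. by rewrite /dot linearD mulmxDl mxE. Qed.

Lemma dotDr x y z : dot z (x + y) = dot z x + dot z y.
Proof. by rewrite /dot mulmxDr mxE. Qed.

Lemma dotZl a x y : dot (a *: x) y = a * dot x y.
Proof. by rewrite /dot linearZ -scalemxAl mxE. Qed.

Lemma dotZr a x y : dot x (a *: y) = a * dot x y.
Proof. by rewrite /dot -scalemxAr mxE. Qed.

Lemma dot_sumr (I : Type) (s : seq I) (P : pred I) (F : I -> 'cV[R]_n) x :
  dot x (\sum_(i <- s | P i) F i) = \sum_(i <- s | P i) dot x (F i).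
Proof. by rewrite /dot mulmx_sumr summxE. Qed.

Lemma dot_ge0 x : 0 <= dot x x.
Proof. by rewrite dotE sumr_ge0 // => i _; rewrite -expr2 sqr_ge0. Qed.

Lemma sqr_coord_le_dot x i : x i 0 ^+ 2 <= dot x x.
Proof.
rewrite dotE (bigD1 i) //= -expr2 lerDl sumr_ge0 // => j _.
by rewrite -expr2 sqr_ge0.
Qed.

Lemma dot_gt0 x : x != 0 -> 0 < dot x x.
Proof.
move=> x0; rewrite lt_neqAle dot_ge0 andbT eq_sym; apply: contra x0 => /eqP d0.
apply/eqP/matrixP => i j; rewrite ord1 mxE; apply/eqP.
by rewrite -sqrf_eq0 eq_le sqr_ge0 andbT -d0 sqr_coord_le_dot.
Qed.

Lemma norm2_ge0 x : 0 <= norm2 x.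
Proof. exact: sqrtr_ge0. Qed.

Lemma sqr_norm2 x : norm2 x ^+ 2 = dot x x.
Proof. by rewrite /norm2 sqr_sqrtr // dot_ge0. Qed.

Lemma norm2_gt0 x : x != 0 -> 0 < norm2 x.
Proof. by move=> /dot_gt0; rewrite sqrtr_gt0. Qed.

Lemma abs_coord_le_norm2 x i : `|x i 0| <= norm2 x.
Proof. by rewrite -sqrtr_sqr ler_sqrt ?dot_ge0 // sqr_coord_le_dot. Qed.

(** Discriminant argument: the form is nonnegative along the whole line [x + s *: y]. *)
Lemma semi_cauchy_schwarz (S : 'M[R]_n) x y : S^T = S ->
  (forall z, 0 <= dot z (S *m z)) ->
  dot x (S *m y) ^+ 2 <= dot x (S *m x) * dot y (S *m y).
Proof.
move=> Ssym Spsd.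
have symB u v : dot u (S *m v) = dot v (S *m u).
  by rewrite dotC /dot trmx_mul Ssym mulmxA.
have expand s : 0 <= dot x (S *m x) + 2 * s * dot x (S *m y)
                     + s ^+ 2 * dot y (S *m y).
  have := Spsd (x + s *: y).
  rewrite mulmxDr -scalemxAr !(dotDl, dotDr, dotZl, dotZr) (symB y x).
  by set a := dot _ _; set c := dot _ _; set d := dot _ _ => H; lra.
set a := dot x (S *m x) in expand *; set c := dot y (S *m y) in expand *.
set d := dot x (S *m y) in expand *.
have [c0|c0] := eqVneq c 0.
  rewrite c0 mulr0 real_leNgt ?num_real //; apply/negP => d2.
  have d0 : d != 0 by apply: contraTneq d2 => ->; rewrite expr0n ltxx.
  (* With [c = 0] the quadratic is affine in [s]; this [s] gives it the value [-1]. *)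
  have := expand (- (a + 1) / (2 * d)).
  rewrite c0 mulr0 addr0.
  have -> : 2 * (- (a + 1) / (2 * d)) * d = - (a + 1) by field.
  by rewrite opprD addrA subrr add0r ler0N1.
have c_gt0 : 0 < c by rewrite lt_neqAle eq_sym c0 Spsd.
have := expand (- d / c).
have -> : a + 2 * (- d / c) * d + (- d / c) ^+ 2 * c = (a * c - d ^+ 2) / c.
  by field.
by rewrite pmulr_lge0 ?invr_gt0 // subr_ge0.
Qed.

Lemma sqr_dot_le x y : dot x y ^+ 2 <= dot x x * dot y y.
Proof.
have := @semi_cauchy_schwarz 1%:M x y (trmx1 _ _); rewrite !mul1mx; apply=> z.
by rewrite mul1mx dot_ge0.
Qed.

Lemma cauchy_schwarz x y : `|dot x y| <= norm2 x * norm2 y.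
Proof.
rewrite -ler_sqr ?nnegrE ?mulr_ge0 ?norm2_ge0 // real_normK ?num_real //.
by rewrite exprMn !sqr_norm2 sqr_dot_le.
Qed.

Lemma norm2B_le x y : norm2 (x - y) <= norm2 x + norm2 y.
Proof.
rewrite -ler_sqr ?nnegrE ?addr_ge0 ?norm2_ge0 // sqr_norm2.
rewrite -scaleN1r !(dotDl, dotDr, dotZl, dotZr) (dotC y x) -!sqr_norm2.
have := cauchy_schwarz x y; rewrite ler_norml => /andP[+ _].
by set a := norm2 x; set c := norm2 y; set d := dot x y => H; nra.
Qed.

Lemma dot_mulmx_le (T : 'M[R]_n) :
  exists2 C, 0 < C & forall x, dot x (T *m x) <= C * dot x x.
Proof.
exists (1 + \sum_i \sum_j `|T i j|).
  rewrite ltr_wpDr //; apply: sumr_ge0 => i _; exact: sumr_ge0.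
move=> x; rewrite mulrDl mul1r; apply: ler_wpDl; first exact: dot_ge0.
rewrite dotE mulr_suml ler_sum // => i _; rewrite mxE mulr_sumr mulr_suml.
apply: ler_sum => j _; rewrite mulrCA (le_trans (ler_norm _)) // normrM.
rewrite ler_wpM2l // normrM.
have := sqr_coord_le_dot x i; have := sqr_coord_le_dot x j.
rewrite -(real_normK (num_real (x i 0))) -(real_normK (num_real (x j 0))).
by set a := `|x i 0|; set c := `|x j 0|; nra.
Qed.

(** Cauchy-Schwarz for the form of [S], applied to [x] and [S^-1 x], gives
    [(x.x)^2 <= (x.Sx) (x.S^-1 x)]; the last factor is at most [C (x.x)]. *)
Lemma psd_unitmx_coercive (S : 'M[R]_n) : S^T = S ->
  (forall x, 0 <= dot x (S *m x)) -> S \in unitmx ->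
  exists2 c, 0 < c & forall x, c * dot x x <= dot x (S *m x).
Proof.
move=> Ssym Spsd Su; have [C C0 HC] := dot_mulmx_le (invmx S).
exists C^-1; first by rewrite invr_gt0.
move=> x; have [->|x0] := eqVneq x 0.
  by rewrite mulmx0 /dot mulmx0 mxE mulr0.
have xx := dot_gt0 x0.
have := @semi_cauchy_schwarz S x (invmx S *m x) Ssym Spsd.
rewrite mulmxA mulmxV // mul1mx (dotC (invmx S *m x)) => CS.
rewrite mulrC ler_pdivrMr // -(ler_pM2r xx) -expr2 (le_trans CS) //.
by rewrite -mulrA ler_wpM2l.
Qed.
End Dot.

(** * Smallest singular value as a lower bound for [|M z| / |z|] *)

Lemma sigma_min_ge0 (R : realType) (m p : nat) (M : 'M[R]_(m, p)) :
  0 <= sigma_min M.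
Proof.
have [[s Ms]|none] := pselect (exists s, singular_value M s).
  by apply: lb_le_inf; [exists s|move=> u []].
(* Without singular values the infimum takes its default value 0. *)
rewrite /sigma_min (_ : [set s | _]%classic = set0) ?inf0 //.
by apply/seteqP; split=> // s Ms; apply: none; exists s.
Qed.

(* The best constant [l] in [l * |x|^2 <= |M x|^2] is an eigenvalue of
   [S = M^T M]: otherwise [S - l] would be invertible and positive
   semidefinite, hence coercive, and [l] could be increased. *)
Lemma sigma_min_le (R : realType) (m p : nat) (M : 'M[R]_(m, p))
    (z : 'cV[R]_p) :
  sigma_min M * norm2 z <= norm2 (M *m z).
Proof.
have [->|z0] := eqVneq z 0.
  by rewrite mulmx0 /norm2 !mulmx0 !mxE sqrtr0 mulr0.
pose S := M^T *m M.
have dotS x : dot x (S *m x) = dot (M *m x) (M *m x).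
  by rewrite /dot /S trmx_mul !mulmxA.
pose E := [set c | forall x, c * dot x x <= dot x (S *m x)]%classic.
have E0 : E 0 by move=> x; rewrite mul0r dotS dot_ge0.
have ubE x : x != 0 -> ubound E (dot x (S *m x) / dot x x).
  by move=> x0 c Ec; rewrite ler_pdivlMr ?dot_gt0.
have hsE : has_sup E by split; [exists 0|exists (dot z (S *m z) / dot z z); exact: ubE].
pose l := sup E.
have l0 : 0 <= l by apply: ub_le_sup => //; exact: hsE.2.
have El : E l.
  move=> x; have [->|x0] := eqVneq x 0.
    by rewrite mulmx0 /dot mulmx0 mxE mulr0.
  rewrite -ler_pdivlMr ?dot_gt0 //; apply: ge_sup; first exact: hsE.1.
  exact: ubE.
have dotSl x : dot x ((S - l%:M) *m x) = dot x (S *m x) - l * dot x x.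
  by rewrite mulmxBl mul_scalar_mx -scaleNr dotDr dotZr mulNr.
have sing : singular_value M (Num.sqrt l).
  split; first exact: sqrtr_ge0.
  rewrite sqr_sqrtr // /eigenvalue /eigenspace kermx_eq0 row_free_unit.
  apply/negP => Su.
  have [|x|c c0 Hc] := psd_unitmx_coercive _ _ Su.
  - by rewrite linearB /= tr_scalar_mx trmx_mul trmxK.
  - by rewrite dotSl subr_ge0.
  have : E (l + c) by move=> x; have := Hc x; rewrite dotSl mulrDl; lra.
  by move=> /(ub_le_sup hsE.2); rewrite -/l gerDl leNgt c0.
have sl : sigma_min M <= Num.sqrt l.
  by apply: ge_inf => //; exists 0 => s [].
apply: le_trans (ler_wpM2r (norm2_ge0 z) sl) _.
rewrite /norm2 -sqrtrM // ler_sqrt ?dot_ge0 //.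
by rewrite -[leRHS]/(dot _ _) -dotS; apply: El.
Qed.

(** * Arnoldi recurrence, residuals and Krylov spaces *)

Section Arnoldi.
Variables (R : realType) (n : nat) (A : 'M[R]_n) (b : 'cV[R]_n) (k : nat).
Variables (eta : nat -> nat -> R) (v : nat -> 'cV[R]_n) (h : nat -> nat -> R).
Variable w : nat -> nat -> 'cV[R]_n.
Hypothesis b_neq0 : b != 0.
Hypothesis arnoldi : inexact_arnoldi A b k eta v h w.
Hypothesis no_breakdown : forall j : nat, (1 <= j <= k)%N -> h j.+1 j != 0.

(** Downward induction from [w_j^{(j)} = h_{j+1,j} v_{j+1}], adding back one subtracted term at a
    time. The errors do not appear, since the subtraction uses the computed [h i j]. *)
Lemma arnoldi_w_tail i j : (i <= j)%N -> (1 <= j <= k)%N ->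
  w j i = \sum_(i.+1 <= l < j.+2) h l j *: v l.
Proof.
move=> ij jk; have /andP[j1 jk'] := jk.
rewrite -(subKn ij); elim: (j - i)%N (leq_subr i j) => [|d IHd] dj.
  rewrite subn0 big_nat1 (arnoldi_v arnoldi) // scalerA divff ?scale1r //.
  exact: no_breakdown.
have jd : (j - d)%N = (j - d.+1).+1 by rewrite subnSK.
rewrite big_ltn; last by rewrite !ltnS leq_subr.
have := IHd (ltnW dj); rewrite {1 2}jd => <-.
rewrite [w j (j - d.+1).+1](arnoldi_w arnoldi) //= ?[h _ _ *: _ + _]addrC ?subrK //.
by rewrite -jd leq_subr.
Qed.

Lemma arnoldi_mul_v j : (1 <= j <= k)%N ->
  A *m v j = \sum_(1 <= l < j.+2) h l j *: v l.
Proof.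
by move=> jk; rewrite -(arnoldi_w0 arnoldi) // arnoldi_w_tail //; case/andP: jk.
Qed.

Lemma arnoldi_v_dot1 j : (1 <= j <= k.+1)%N -> dot (v j) (v j) = 1.
Proof.
case: j => [//|[|j]] jk.
  rewrite (arnoldi_start arnoldi) dotZl dotZr -sqr_norm2 mulrA -expr2 -exprMn.
  by rewrite mulVf ?expr1n // gt_eqF // norm2_gt0.
have jk' : (1 <= j.+1 <= k)%N by [].
have h0 := no_breakdown jk'.
rewrite (arnoldi_v arnoldi) // dotZl dotZr -sqr_norm2 -(arnoldi_hsub arnoldi) //.
by rewrite mulrA -expr2 -exprMn mulVf ?expr1n.
Qed.

Lemma basis_mx_mul m (z : 'cV[R]_m) :
  basis_mx v m *m z = \sum_i z i 0 *: v i.+1.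
Proof.
apply/matrixP => i j; rewrite ord1 !mxE summxE; apply: eq_bigr => l _.
by rewrite !mxE mulrC.
Qed.

Lemma arnoldi_relation : A *m basis_mx v k = basis_mx v k.+1 *m hessenberg_mx h k.
Proof.
have colV l : col l (basis_mx v k) = v l.+1.
  by apply/matrixP => i j; rewrite ord1 !mxE.
apply/matrixP => i l.
have -> : (A *m basis_mx v k) i l = (A *m v l.+1) i 0.
  by rewrite -colV colE mulmxA -colE [RHS]mxE.
rewrite arnoldi_mul_v ?ltn_ord // big_add1 summxE /=.
rewrite mxE (big_nat_widen _ _ k.+1) ?ltnS ?ltn_ord // big_mkord big_mkcond.
apply: eq_bigr => m _; rewrite !mxE ltnS /=; case: ifP => _; last by rewrite mulr0.
by rewrite mulrC.
Qed.

Lemma basis_mx_e1 : basis_mx v k.+1 *m (norm2 b *: e1 k) = b.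
Proof.
rewrite basis_mx_mul (bigD1 ord0) //= big1 => [|i /negPf i0]; last first.
  by rewrite !mxE i0 mulr0 scale0r.
rewrite !mxE !eqxx mulr1 addr0 (arnoldi_start arnoldi) scalerA divff ?scale1r //.
by rewrite gt_eqF // norm2_gt0.
Qed.

(** Inexact inner products leave the Arnoldi relation exact, so every residual over the columns of
    [V_k] becomes [V g] with [g] a projected residual. *)
Lemma arnoldi_residual z :
  b - A *m (basis_mx v k *m z)
  = basis_mx v k.+1 *m (norm2 b *: e1 k - hessenberg_mx h k *m z).
Proof. by rewrite mulmxBr basis_mx_e1 !mulmxA arnoldi_relation. Qed.

(** The errors spoil orthogonality but not the span: by induction, multiplying by [A] raises the
    index of either span by one. *)
Lemma krylov_span j : (j <= k)%N ->
  krylov A b j = <<[seq v i.+1 | i <- iota 0 j]>>%VS.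
Proof.
pose S m := <<[seq v i.+1 | i <- iota 0 m]>>%VS.
have memS m i : (i < m)%N -> v i.+1 \in S m.
  move=> im; apply: memv_span; apply/mapP; exists i => //.
  by rewrite mem_iota.
have memK m i : (i < m)%N -> A ^+ i *m b \in krylov A b m.
  move=> im; apply: memv_span; apply/mapP; exists i => //.
  by rewrite mem_iota.
have subS m m' : (m <= m')%N -> (S m <= S m')%VS.
  move=> mm; apply/span_subvP => u /mapP[i].
  rewrite mem_iota /= => im ->; exact: memS (leq_trans im mm).
have powS m : A ^+ m.+1 *m b = A *m (A ^+ m *m b) by rewrite mulmxA exprS.
have mulS m u : (m < k)%N -> u \in S m -> A *m u \in S m.+1.
  move=> mk /coord_span ->; rewrite mulmx_sumr.
  apply: rpred_sum => i _; rewrite -scalemxAr rpredZ //.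
  have im : (i < m)%N by rewrite (leq_trans (ltn_ord i)) // size_map size_iota.
  rewrite (nth_map 0%N) ?size_iota // nth_iota // add0n.
  rewrite arnoldi_mul_v ?(leq_trans im (ltnW mk)) // big_add1 /= big_mkord.
  apply: rpred_sum => l _; rewrite rpredZ // memS //.
  by rewrite (leq_trans (ltn_ord l)).
have mulK m u : u \in krylov A b m -> A *m u \in krylov A b m.+1.
  move=> /coord_span ->; rewrite mulmx_sumr.
  apply: rpred_sum => i _; rewrite -scalemxAr rpredZ //.
  have im : (i < m)%N by rewrite (leq_trans (ltn_ord i)) // size_map size_iota.
  rewrite (nth_map 0%N) ?size_iota // nth_iota // add0n.
  by rewrite -powS memK.
elim: j => [//|j IHj] jk; have IH := IHj (ltnW jk).
apply/eqP; rewrite -/(S j.+1) eqEsubv; apply/andP; split; apply/span_subvP => u.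
  move=> /mapP[i]; rewrite mem_iota leq0n andTb add0n ltnS leq_eqVlt.
  case/orP => [/eqP -> ->|ij ->]; last first.
    by apply/(subvP (subS _ _ (leqnSn j))); rewrite /S -IH memK.
  case: j jk IH {IHj} => [|j] jk IH.
    have -> : A ^+ 0 *m b = norm2 b *: v 1%N.
      rewrite expr0 mul1mx (arnoldi_start arnoldi) scalerA divff ?scale1r //.
      by rewrite gt_eqF // norm2_gt0.
    by rewrite rpredZ // memS.
  by rewrite powS mulS // /S -IH memK.
move=> /mapP[i]; rewrite mem_iota leq0n andTb add0n ltnS leq_eqVlt.
have subK : (krylov A b j <= krylov A b j.+1)%VS.
  apply/span_subvP => x /mapP[l]; rewrite mem_iota /= => lj ->.
  exact: memK (leq_trans lj (leqnSn j)).
case/orP => [/eqP -> ->|ij ->]; last by apply: (subvP subK); rewrite IH memS.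
case: j jk IH {IHj} subK => [|j] jk IH subK.
  rewrite (arnoldi_start arnoldi) rpredZ //.
  by have := memK 1%N 0%N isT; rewrite expr0 mul1mx.
have j1k : (1 <= j.+1 <= k)%N by apply: ltnW.
have := arnoldi_mul_v j1k; rewrite big_nat_recr //= => E.
(* The recurrence is solved for its newest vector, which needs a nonzero subdiagonal entry. *)
have -> : v j.+2 = (h j.+2 j.+1)^-1 *:
    (A *m v j.+1 - \sum_(1 <= l < j.+2) h l j.+1 *: v l).
  rewrite E [X in X - _]addrC addrK scalerA mulVf ?scale1r //; exact: no_breakdown.
rewrite rpredZ // rpredB //; first by apply: mulK; rewrite IH; exact: memS.
apply: (subvP subK); rewrite IH big_add1 /= big_mkord.
by apply: rpred_sum => l _; rewrite rpredZ //; exact: memS (ltn_ord l).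
Qed.

(** Lets the exact GMRES iterate be written with the inexact basis. The columns may be dependent;
    [coord] picks one representation. *)
Lemma mem_krylovP u :
  reflect (exists z, u = basis_mx v k *m z) (u \in krylov A b k).
Proof.
rewrite krylov_span //; apply: (iffP idP) => [|[z ->]]; last first.
  rewrite basis_mx_mul; apply: rpred_sum => i _; rewrite rpredZ //.
  apply: memv_span; apply/mapP; exists (i : nat) => //.
  by rewrite mem_iota /=.
have sz : size [seq v i.+1 | i <- iota 0 k] == k by rewrite size_map size_iota.
move=> /(@coord_span _ _ _ (Tuple sz)) ->.
exists (\col_i coord (Tuple sz) i u); rewrite basis_mx_mul.
apply: eq_bigr => i _.
by rewrite mxE (nth_map 0%N) ?size_iota // nth_iota.
Qed.

(** * Loss of orthogonality *)

Definition upper_gram : 'M[R]_k.+1 :=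
  \matrix_(i, j) if (i < j)%N then dot (v i.+1) (v j.+1) else 0.

(** Exact normalisation makes the diagonal of [V^T V] equal to 1, and [U] and [U^T] have the same
    quadratic form. *)
Lemma gram_dot (g : 'cV[R]_k.+1) :
  dot (basis_mx v k.+1 *m g) (basis_mx v k.+1 *m g)
  = dot g g + 2 * dot g (upper_gram *m g).
Proof.
have VV : (basis_mx v k.+1)^T *m basis_mx v k.+1
    = 1%:M + upper_gram + upper_gram^T.
  apply/matrixP => i j; rewrite !mxE.
  rewrite (_ : \sum_l _ = dot (v i.+1) (v j.+1)); last first.
    by rewrite dotE; apply: eq_bigr => l _; rewrite !mxE.
  case: (ltngtP i j) => ij; rewrite -val_eqE /=.
  - by rewrite ltn_eqF // add0r addr0.
  - by rewrite gtn_eqF // !add0r dotC.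
  - by rewrite (val_inj ij) eqxx !addr0 arnoldi_v_dot1 //= ltnS.
rewrite /dot trmx_mul -mulmxA (mulmxA _ _ g) VV !mulmxDl mul1mx.
rewrite -/(dot g (_ + _ + _)) !dotDr [dot g (upper_gram^T *m g)]dotC.
by rewrite /dot trmx_mul trmxK mulmxA; ring.
Qed.

Lemma upper_gram_e1 a : upper_gram *m (a *: e1 k) = 0.
Proof.
apply/matrixP => i j; rewrite !mxE big1 // => l _; rewrite !mxE.
case: eqVneq => [->|]; first by rewrite ltn0 mul0r.
by rewrite mulr0 mulr0.
Qed.

(* Local loss of orthogonality: [v_i^T w_j^{(i)} = - eta_{ij}], while
   [w_j^{(i)}] is the tail [h_{i+1,j} v_{i+1} + ... + h_{j+1,j} v_{j+1}]. *)
Lemma upper_gram_hessenberg (i : 'I_k.+1) (l : 'I_k) :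
  (upper_gram *m hessenberg_mx h k) i l
  = if (i <= l)%N then - eta i.+1 l.+1 else 0.
Proof.
rewrite mxE; under eq_bigr do rewrite !mxE.
case: leqP => il; last first.
  rewrite big1 // => m _; case: ltnP => im; last by rewrite mul0r.
  by rewrite leqNgt (leq_ltn_trans il im) mulr0.
have jk : (1 <= l.+1 <= k)%N by rewrite ltn_ord.
have i1k : (1 <= i.+1 <= k.+1)%N by exact: ltn_ord.
have i1l : (1 <= i.+1 <= l.+1)%N by [].
have -> : - eta i.+1 l.+1 = dot (v i.+1) (w l.+1 i.+1).
  rewrite (arnoldi_w arnoldi) // -scaleNr dotDr dotZr arnoldi_v_dot1 //.
  rewrite (arnoldi_h arnoldi) // mulr1 -[((v _)^T *m _) 0 0]/(dot _ _).
  by rewrite /= opprD addrA subrr add0r.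
rewrite arnoldi_w_tail // dot_sumr big_add1 /=.
rewrite (big_nat_widen _ _ k.+1) ?ltnS ?ltn_ord // big_geq_mkord [RHS]big_mkcond.
apply: eq_bigr => m _; rewrite dotZr ltnS.
case: ltnP => im; case: leqP => ml; rewrite ?mul0r ?mulr0 //.
by rewrite mulrC.
Qed.

(** Each coordinate is at most [c] times the sum of the [phi j], hence at most [sqrt k * c] by
    Cauchy-Schwarz against the all-ones vector. *)
Lemma upper_gram_res_le (phi : nat -> R) (c : R) (z : 'cV[R]_k) :
  \sum_(1 <= j < k.+1) phi j ^+ 2 <= 1 -> 0 <= c ->
  (forall (i : nat) (l : 'I_k), (i <= l)%N ->
     `|eta i.+1 l.+1| * `|z l 0| <= phi l.+1 * c) ->
  (forall l : 'I_k, 0 <= phi l.+1) ->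
  norm2 (upper_gram *m (norm2 b *: e1 k - hessenberg_mx h k *m z)) <= k%:R * c.
Proof.
move=> phi1 c0 etaz phi0; rewrite mulmxBr upper_gram_e1 sub0r mulmxA.
set u := - _; pose p : 'cV[R]_k := \col_l phi l.+1.
have kc0 : 0 <= k%:R * c by rewrite mulr_ge0.
have sum_phi : (\sum_(l < k) phi l.+1) ^+ 2 <= k%:R.
  have := sqr_dot_le p (const_mx 1); rewrite !dotE.
  under eq_bigr do rewrite !mxE mulr1.
  under [X in _ <= X * _]eq_bigr do rewrite !mxE -expr2.
  under [X in _ <= _ * X]eq_bigr do rewrite !mxE mulr1.
  move=> /le_trans; apply; rewrite sumr_const card_ord.
  by move: phi1; rewrite big_add1 big_mkord => phi1; rewrite ler_piMl.
have ui i : u i 0 ^+ 2 <= k%:R * c ^+ 2.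
  have le_u : `|u i 0| <= (\sum_(l < k) phi l.+1) * c.
    rewrite !mxE normrN mulr_suml (le_trans (ler_norm_sum _ _ _)) //.
    apply: ler_sum => l _; rewrite upper_gram_hessenberg normrM.
    case: leqP => il; first by rewrite normrN etaz.
    by rewrite normr0 mul0r mulr_ge0.
  rewrite -real_normK ?num_real // (le_trans (lerXn2r 2 _ _ le_u)) ?nnegrE //.
    by rewrite mulr_ge0 // sumr_ge0.
  by rewrite exprMn ler_wpM2r // sqr_ge0.
(* The last row of [U] is zero, so only [k] of the [k + 1] coordinates count and the bound is
   [k c]. *)
have umax : u ord_max 0 = 0.
  rewrite !mxE big1 ?oppr0 // => l _.
  by rewrite upper_gram_hessenberg leqNgt ltn_ord mul0r.
rewrite -ler_sqr ?nnegrE ?norm2_ge0 // sqr_norm2 dotE big_ord_recr /=.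
rewrite umax mul0r addr0 exprMn.
apply: le_trans (_ : \sum_(i < k) k%:R * c ^+ 2 <= _).
  by apply: ler_sum => i _; rewrite -expr2.
by rewrite sumr_const card_ord -[_ *+ k]mulr_natl mulrA expr2.
Qed.

(** * Comparison with the smaller projected problems *)

(** Pad [z] with zeros: the first [l] columns of [H_k] are those of [H_l] extended by zeros. *)
Lemma hessenberg_pad (l : 'I_k) (z : 'cV[R]_l) (a : R) :
  exists2 p : 'cV[R]_k, p l 0 = 0 &
    norm2 (a *: e1 k - hessenberg_mx h k *m p)
    = norm2 (a *: e1 l - hessenberg_mx h l *m z).
Proof.
have lk : (l < k)%N := ltn_ord l.
pose f m := oapp (fun i => z i 0) 0 (insub m : option 'I_l).
have f_out m : (l <= m)%N -> f m = 0.
  by move=> lm; rewrite /f insubF // ltnNge lm.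
have f_in (m : 'I_l) : f m = z m 0 by rewrite /f valK.
(* Entry [i] of both residuals, as one function on [nat]; it vanishes for [i > l]. *)
pose g i := a * (i == 0%N)%:R
            - \sum_(m < l) (if (i <= m.+1)%N then h i.+1 m.+1 else 0) * f m.
exists (\col_m f m); first by rewrite mxE f_out.
congr (Num.sqrt _); rewrite -!/(dot _ _) !dotE.
have gl (i : 'I_l.+1) : (a *: e1 l - hessenberg_mx h l *m z) i 0 = g i.
  rewrite !mxE -val_eqE /= andbT; congr (_ - _).
  by apply: eq_bigr => m _; rewrite mxE f_in.
have gk (i : 'I_k.+1) :
    (a *: e1 k - hessenberg_mx h k *m (\col_m f m)) i 0 = g i.
  rewrite !mxE -val_eqE /= andbT; congr (_ - _).
  rewrite (big_ord_widen k
    (fun m : nat => (if (i <= m.+1)%N then h i.+1 m.+1 else 0) * f m) (ltnW lk)).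
  rewrite [RHS]big_mkcond; apply: eq_bigr => m _; rewrite !mxE.
  by case: ltnP => // /f_out ->; rewrite mulr0.
under eq_bigr do rewrite gk.
under [RHS]eq_bigr do rewrite gl.
rewrite [RHS](big_ord_widen k.+1 (fun i : nat => g i * g i)) ?ltnS ?(ltnW lk) //.
rewrite [RHS]big_mkcond; apply: eq_bigr => i _.
case: ltnP => // li; rewrite (_ : g i = 0) ?mul0r //.
rewrite /g gtn_eqF ?(leq_ltn_trans _ li) // mulr0 big1 ?subr0 // => m _.
by rewrite leqNgt (leq_ltn_trans (ltn_ord m) li) mul0r.
Qed.

(** The padded vector [p] vanishes at [l], so [y l 0] is a coordinate of [y - p], and [H_k (y - p)]
    is a difference of two residuals. Counting from 0, coordinate [l] is paired with step [l], as
    [eta_{l+1}] requires. *)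
Lemma sigma_min_coord_le (l : 'I_k) (z : 'cV[R]_l) (y : 'cV[R]_k) (a : R) :
  sigma_min (hessenberg_mx h k) * `|y l 0|
  <= norm2 (a *: e1 l - hessenberg_mx h l *m z)
     + norm2 (a *: e1 k - hessenberg_mx h k *m y).
Proof.
have [p p0 <-] := hessenberg_pad z a.
have -> : y l 0 = (y - p) l 0 by rewrite !mxE p0 subr0.
apply: le_trans (ler_wpM2l (sigma_min_ge0 _) (abs_coord_le_norm2 _ _)) _.
apply: le_trans (sigma_min_le _ _) _; rewrite mulmxBr.
apply: le_trans (norm2B_le _ _); rewrite le_eqVlt; apply/orP; left; apply/eqP.
by congr norm2; rewrite opprB [RHS]addrC addrA subrK.
Qed.

Lemma lsq_residual_norm2_le (l : 'I_k) (z : 'cV[R]_l) (y : 'cV[R]_k) (a : R) :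
  lsq_solution (hessenberg_mx h k) (a *: e1 k) y ->
  norm2 (a *: e1 k - hessenberg_mx h k *m y)
  <= norm2 (a *: e1 l - hessenberg_mx h l *m z).
Proof. by move=> y_lsq; have [p _ <-] := hessenberg_pad z a; apply: y_lsq. Qed.

End Arnoldi.

Theorem theorem1 (R : realType) (n : nat) (A : 'M[R]_n) (b : 'cV[R]_n)
    (b_neq0 : b != 0) (k : nat) (k_gt0 : (0 < k)%N)
    (xe re : 'cV[R]_n)
    (xe_gmres : gmres_iterate A b k xe)
    (re_def : re = b - A *m xe)
    (eta : nat -> nat -> R) (v : nat -> 'cV[R]_n) (h : nat -> nat -> R)
    (w : nat -> nat -> 'cV[R]_n)
    (arnoldi : inexact_arnoldi A b k eta v h w)
    (no_breakdown : forall j : nat, (1 <= j <= k)%N -> h j.+1 j != 0)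
    (y : 'cV[R]_k) (t : forall j : nat, 'cV[R]_j.+1)
    (y_lsq : lsq_solution (hessenberg_mx h k) (norm2 b *: e1 k) y)
    (tk_def : t k = norm2 b *: e1 k - hessenberg_mx h k *m y)
    (t_lsq : forall j : nat, (1 <= j < k)%N ->
       lsq_residual (hessenberg_mx h j) (norm2 b *: e1 j) (t j))
    (t0_def : t 0%N = norm2 b *: e1 0%N)
    (x r : 'cV[R]_n)
    (x_def : x = basis_mx v k *m y)
    (r_def : r = b - A *m x)
    (eps : R) (eps_gt0 : 0 < eps) (eps_lt1 : eps < 1)
    (phi : nat -> R)
    (phi_gt0 : forall j : nat, (1 <= j <= k)%N -> 0 < phi j)
    (phi_sum : \sum_(1 <= j < k.+1) phi j ^+ 2 <= 1)
    (eta_le : forall i j : nat, (1 <= j <= k)%N -> (1 <= i <= j)%N ->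
       `|eta i j| <=
         phi j * eps * sigma_min (hessenberg_mx h k) / Num.sqrt 2
         * (norm2 b / norm2 (t j.-1))) :
  (1 <= norm2 r / norm2 re /\ norm2 r / norm2 re <= Num.sqrt 3) \/
  norm2 (t k) / norm2 b <= 6 * k%:R * eps.
Proof.
have [tk_le|tk_gt] := leP (norm2 (t k) / norm2 b) (6 * k%:R * eps); [by right|left].
have b0 : 0 < norm2 b by apply: norm2_gt0.
rewrite ltr_pdivlMr // in tk_gt.
set T := norm2 (t k) in tk_gt.
have k0 : 0 < k%:R :> R by rewrite ltr0n.
have T0 : 0 < T by apply: le_lt_trans tk_gt; rewrite !mulr_ge0 // ltW.
have sqrt2_gt0 : 0 < Num.sqrt 2 :> R by rewrite sqrtr_gt0.
have sqrt2_sqr : Num.sqrt 2 ^+ 2 = 2 :> R by rewrite sqr_sqrtr.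
pose res z := norm2 b *: e1 k - hessenberg_mx h k *m z.
have t_res (l : 'I_k) : exists z : 'cV[R]_l,
    t l = norm2 b *: e1 l - hessenberg_mx h l *m z.
  (* [H_0] has no columns, so [t 0] is the residual of the empty vector. *)
  case: l => -[|l] /= lk; last by have [|z _ ->] := t_lsq l.+1; [|exists z].
  by exists 0; rewrite mulmx0 subr0.
have T_le_t (l : 'I_k) : T <= norm2 (t l).
  have [z ->] := t_res l; rewrite /T tk_def; exact: lsq_residual_norm2_le.
have gram_res z : 2 * dot (basis_mx v k.+1 *m res z) (basis_mx v k.+1 *m res z)
      <= 3 * norm2 (res z) ^+ 2
    /\ norm2 (res z) ^+ 2
      <= 2 * dot (basis_mx v k.+1 *m res z) (basis_mx v k.+1 *m res z).
  set g := norm2 (res z).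
  have Tg : T <= g by rewrite /T tk_def; apply: y_lsq.
  have g0 : 0 < g by apply: lt_le_trans Tg.
  (* The factor [2 * g / T] bounds [(|t_l| + g) / |t_l|], because both [|t_l|] and [g] are at least
     [T]. *)
  pose c := eps * norm2 b / Num.sqrt 2 * (2 * g / T).
  have c0 : 0 <= c by rewrite !mulr_ge0 ?invr_ge0 // ltW.
  have Ug : norm2 (upper_gram k v *m res z) <= g / 4.
    apply: le_trans (upper_gram_res_le b_neq0 arnoldi no_breakdown phi_sum c0 _ _) _.
    - move=> i l il; have [z' tl] := t_res l.
      have tl0 : 0 < norm2 (t l) := lt_le_trans T0 (T_le_t l).
      have jk : (1 <= l.+1 <= k)%N by rewrite ltn_ord.
      have := eta_le i.+1 l.+1 jk il; move=> /(ler_wpM2r (normr_ge0 (z l 0))).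
      move=> /le_trans; apply.
      have := sigma_min_coord_le h z' z (norm2 b); rewrite -tl -/(res z) -/g /= => sz.
      have -> : phi l.+1 * eps * sigma_min (hessenberg_mx h k) / Num.sqrt 2 *
          (norm2 b / norm2 (t l)) * `|z l 0|
        = phi l.+1 * (eps * norm2 b / Num.sqrt 2 *
            ((sigma_min (hessenberg_mx h k) * `|z l 0|) / norm2 (t l))).
        by field; rewrite !gt_eqF.
      rewrite ler_wpM2l ?(ltW (phi_gt0 _ jk)) // ler_wpM2l //.
        by rewrite !mulr_ge0 ?invr_ge0 // ltW.
      rewrite ler_pdivrMr // (le_trans sz) // mulrAC ler_pdivlMr //.
      have := T_le_t l; set u := norm2 (t l) => Tu; nra.
    - by move=> l; rewrite ltW // phi_gt0 //= ltn_ord.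
    (* The first factor is below 1 because the second alternative fails; the other is at most
       [g / 4] because [sqrt 2 <= 3 / 2]. This fixes the constant 6. *)
    have -> : k%:R * c = (6 * k%:R * eps * norm2 b / T) * (g * Num.sqrt 2 / 6).
      rewrite /c -[X in X * g]sqrt2_sqr; field.
      by rewrite !gt_eqF.
    have q1 : 6 * k%:R * eps * norm2 b / T <= 1 by rewrite ler_pdivrMr ?mul1r // ltW.
    apply: le_trans (ler_wpM2r _ q1) _; first by rewrite !mulr_ge0 ?invr_ge0 ?sqrtr_ge0 ?ltW.
    have : Num.sqrt 2 <= 3 / 2 :> R by rewrite -ler_sqr ?nnegrE ?sqrtr_ge0 ?divr_ge0 // sqrt2_sqr; lra.
    by move=> s_le; nra.
  (* Now [|g^T U g| <= |g|^2 / 4], so [|V g|^2] differs from [|g|^2] by at most [|g|^2 / 2]. *)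
  have := cauchy_schwarz (res z) (upper_gram k v *m res z).
  rewrite ler_norml -/g => /andP[lo hi].
  have gUg : g * norm2 (upper_gram k v *m res z) <= g ^+ 2 / 4.
    by rewrite expr2 -mulrA ler_wpM2l // ltW.
  rewrite (gram_dot b_neq0 arnoldi no_breakdown) -sqr_norm2 -/g.
  by split; lra.
have r_res : r = basis_mx v k.+1 *m res y.
  by rewrite r_def x_def (arnoldi_residual b_neq0 arnoldi no_breakdown).
have [xeK xe_min] := xe_gmres.
have /(mem_krylovP b_neq0 arnoldi no_breakdown)[ye xeE] := xeK.
have re_res : re = basis_mx v k.+1 *m res ye.
  by rewrite re_def xeE (arnoldi_residual b_neq0 arnoldi no_breakdown).
(* The upper bound for [r] and the lower bound for [re] differ by a factor [(3/2) / (1/2) = 3] in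
   the squares. *)
have [r_le _] := gram_res y; rewrite -r_res -sqr_norm2 in r_le.
have [_ re_ge] := gram_res ye; rewrite -re_res -sqr_norm2 in re_ge.
have T_le : norm2 (res y) <= norm2 (res ye) by apply: y_lsq.
have T_res : norm2 (res y) = T by rewrite /T tk_def.
have T_le2 : norm2 (res y) ^+ 2 <= norm2 (res ye) ^+ 2.
  by rewrite lerXn2r ?nnegrE ?norm2_ge0.
have re0 : 0 < norm2 re.
  rewrite lt_neqAle norm2_ge0 andbT eq_sym; apply/eqP => re0.
  have : 0 < norm2 (res y) ^+ 2 by rewrite T_res exprn_gt0.
  by move: re_ge; rewrite re0; lra.
rewrite ler_pdivlMr // mul1r ler_pdivrMr //; split.
  (* [x] lies in the Krylov space, so exact GMRES does at least as well. *)
  rewrite re_def r_def; apply: xe_min.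
  by apply/(mem_krylovP b_neq0 arnoldi no_breakdown); exists y.
rewrite -ler_sqr ?nnegrE ?mulr_ge0 ?norm2_ge0 ?sqrtr_ge0 // exprMn (sqr_sqrtr (ler0n _ 3)).
lra.
Qed.
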